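(* The affine Kac-Moody superalgebras $G(3)^{(1)}$ and $G(3)^{(2)}$ are isomorphic.
   Context: The ground field is $\mathbb C$. $G(3)$ is the exceptional basic classical simple Lie superalgebra of dimension $31$ (even part $G_2\times\mathfrak{sl}_2$), with Cartan subalgebra $\mathfrak h$, set of simple roots $\alpha_1,\alpha_2,\alpha_3$ and nondegenerate invariant even supersymmetric bilinear form $(-,-)$. $G(3)^{(1)}=G(3)\otimes\mathbb C[t^{\pm1}]\oplus\mathbb CK\oplus\mathbb Cd$ is the (untwisted) affinization: $[x\otimes t^i,y\otimes t^j]=[x,y]\otimes t^{i+j}+i\,\delta_{i+j,0}(x,y)K$, $K$ central, $[d,x\otimes t^i]=i\,x\otimes t^i$. In van de Leur's classification of symmetrizable affine Lie superalgebras, $G(3)^{(2)}$ denotes the twisted affinization of $G(3)$ with respect to the order two automorphism $\sigma=\exp(\operatorname{ad}h)$, where $h\in\mathfrak h$ is such that $\langle h,\alpha_1\rangle=\pi i$, $\langle h,\alpha_2\rangle=\langle h,\alpha_3\rangle=0$; i.e. $G(3)^{(2)}=\bigoplus_{j\in\mathbb Z}(G(3)_{j\bmod 2}\otimes t^j)\oplus\mathbb CK\oplus\mathbb Cd$ with the same bracket formulas, where $G(3)_0$ and $G(3)_1$ are the eigenspaces of $\sigma$ with eigenvalues $1$ and $-1$. *)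

(* Defs.v *)
From HB Require Import structures.
From mathcomp Require Import all_boot all_order all_algebra.
From mathcomp Require Import complex.
From mathcomp Require Import all_classical all_reals all_analysis.

Set Implicit Arguments.
Unset Strict Implicit.
Unset Printing Implicit Defensive.

Import Order.TTheory GRing.Theory Num.Theory numFieldNormedType.Exports.
Local Open Scope classical_set_scope.
Local Open Scope ring_scope.

(* [spart p] is the homogeneous part of parity [p], odd for [p = true]. *)
HB.mixin Record isLieSuper (F : numFieldType) V of GRing.Lmodule F V := {
  spart : bool -> set V;
  br : V -> V -> V;
  spart_lin : forall p a x y, spart p x -> spart p y -> spart p (a *: x + y);
  spart_split : forall x,
    exists x0 x1, [/\ spart false x0, spart true x1 & x = x0 + x1];
  spart_cap : forall x, spart false x -> spart true x -> x = 0;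
  br_linl : forall a x y z, br (a *: x + y) z = a *: br x z + br y z;
  br_linr : forall a x y z, br x (a *: y + z) = a *: br x y + br x z;
  br_spart : forall p q x y,
    spart p x -> spart q y -> spart (p (+) q) (br x y);
  br_anti : forall p q x y, spart p x -> spart q y ->
    br x y = - ((-1) ^+ (p && q) *: br y x);
  br_jacobi : forall p q r x y z, spart p x -> spart q y -> spart r z ->
    br x (br y z) = br (br x y) z + (-1) ^+ (p && q) *: br y (br x z)
}.

#[short(type="lieSuperType")]
HB.structure Definition LieSuper (F : numFieldType) :=
  {V of isLieSuper F V & GRing.Lmodule F V}.

#[short(type="finLieSuperType")]
HB.structure Definition FinLieSuper (F : numFieldType) :=
  {V of isLieSuper F V & Vector F V}.

Definition lsiso (F : numFieldType) (L L' : lieSuperType F) : Prop :=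
  exists phi : {linear L -> L'},
    [/\ bijective phi,
        forall p x, spart p x -> spart p (phi x)
      & forall x y, phi (br x y) = br (phi x) (phi y)].

Record lsAut (F : numFieldType) (L : lieSuperType F) := LsAut {
  lsaut :> {linear L -> L};
  lsaut_bij : bijective lsaut;
  lsaut_spart : forall p x, spart p x -> spart p (lsaut x);
  lsaut_br : forall x y, lsaut (br x y) = br (lsaut x) (lsaut y)
}.

Record invForm (F : numFieldType) (L : lieSuperType F) := InvForm {
  bform :> L -> L -> F;
  bform_linl : forall a x y z,
    bform (a *: x + y) z = a * bform x z + bform y z;
  bform_linr : forall a x y z,
    bform x (a *: y + z) = a * bform x y + bform x z;
  bform_even : forall x y, spart false x -> spart true y -> bform x y = 0;
  bform_supersym : forall p q x y, spart p x -> spart q y ->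
    bform x y = (-1) ^+ (p && q) * bform y x;
  bform_inv : forall x y z, bform (br x y) z = bform x (br y z);
  bform_nondeg : forall x, (forall y, bform x y = 0) -> x = 0
}.

Section LieSuperTheory.
Variables (F : numFieldType) (L : lieSuperType F).
Implicit Types x y z : L.

Lemma spart0 p : spart p (0 : L).
Proof.
have [x0 [x1 [h0 h1 _]]] := spart_split (0 : L).
by case: p; [have := spart_lin _ (-1) _ _ h1 h1
            |have := spart_lin _ (-1) _ _ h0 h0]; rewrite scaleN1r addNr.
Qed.

Lemma spartD p x y : spart p x -> spart p y -> spart p (x + y).
Proof. by move=> hx hy; rewrite -[x]scale1r; apply: spart_lin. Qed.

Lemma spartZ p a x : spart p x -> spart p (a *: x).
Proof. by move=> hx; rewrite -[a *: x]addr0; apply: spart_lin (spart0 p). Qed.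

Lemma spartB p x y : spart p x -> spart p y -> spart p (x - y).
Proof. by move=> hx hy; rewrite addrC -scaleN1r; apply: spart_lin. Qed.

Lemma brDl x y z : br (x + y) z = br x z + br y z.
Proof. by rewrite -{1}[x]scale1r br_linl scale1r. Qed.

Lemma brDr x y z : br x (y + z) = br x y + br x z.
Proof. by rewrite -{1}[y]scale1r br_linr scale1r. Qed.

Lemma br0l x : br 0 x = 0.
Proof. by apply: (addrI (br 0 x)); rewrite -brDl !addr0. Qed.

Lemma br0r x : br x 0 = 0.
Proof. by apply: (addrI (br x 0)); rewrite -brDr !addr0. Qed.

Lemma brZl a x y : br (a *: x) y = a *: br x y.
Proof. by rewrite -[a *: x]addr0 br_linl br0l addr0. Qed.

Lemma brZr a x y : br x (a *: y) = a *: br x y.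
Proof. by rewrite -[a *: y]addr0 br_linr br0r addr0. Qed.

Variable B : invForm L.

Lemma bformDl x y z : B (x + y) z = B x z + B y z.
Proof. by rewrite -{1}[x]scale1r bform_linl mul1r. Qed.

Lemma bformDr x y z : B x (y + z) = B x y + B x z.
Proof. by rewrite -{1}[y]scale1r bform_linr mul1r. Qed.

Lemma bform0l x : B 0 x = 0.
Proof. by apply: (addrI (B 0 x)); rewrite -bformDl !addr0. Qed.

Lemma bform0r x : B x 0 = 0.
Proof. by apply: (addrI (B x 0)); rewrite -bformDr !addr0. Qed.

Lemma bformZl a x y : B (a *: x) y = a * B x y.
Proof. by rewrite -[a *: x]addr0 bform_linl bform0l addr0. Qed.

Lemma bformZr a x y : B x (a *: y) = a * B x y.
Proof. by rewrite -[a *: y]addr0 bform_linr bform0r addr0. Qed.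

End LieSuperTheory.

(* V (x) F[t, t^-1]: the coefficient function of sum_j f j (x) t^j. *)
Definition loop_pred (V : zmodType) : {pred int -> V} :=
  [pred f : int -> V | `[< finite_set [set j | f j != 0] >]].

Record loop (V : zmodType) := Loop {
  coefs :> int -> V;
  _ : coefs \in @loop_pred V
}.

Section LoopInst.
Variables (F : numFieldType) (V : lmodType F).

HB.instance Definition _ := [isSub of loop V for @coefs V].
HB.instance Definition _ := [Choice of loop V by <:].

Lemma loop_submod_closed : submod_closed (@loop_pred V).
Proof.
split=> [|a f g /asboolP hf /asboolP hg]; apply/asboolP.
  by apply: (sub_finite_set _ (finite_set0 _)) => j /=; rewrite eqxx.
apply: (@sub_finite_set _ _ ([set j | f j != 0] `|` [set j | g j != 0])).
  move=> j /= hj; apply/orP; apply: contraNT hj; rewrite negb_or !negbK.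
  by case/andP=> /eqP hfj /eqP hgj; rewrite /= /GRing.add /= /GRing.scale /= hfj hgj scaler0 addr0.
by rewrite finite_setU.
Qed.
HB.instance Definition _ := GRing.isSubmodClosed.Build F (int -> V)
  (@loop_pred V) loop_submod_closed.
HB.instance Definition _ := [SubChoice_isSubLmodule of loop V by <:].
End LoopInst.

Section LoopTheory.
Variables (F : numFieldType) (V : lmodType F).
Implicit Types f g : loop V.

Lemma loop_seq f : exists2 s, uniq s & forall j, f j != 0 -> j \in s.
Proof.
have /asboolP/finite_seqP[s hs] := valP f.
exists (undup s); first exact: undup_uniq.
by move=> j hj; rewrite mem_undup; have : [set` s] j by rewrite -hs.
Qed.

Lemma loop_predI (f : int -> V) (s : seq int) :
  (forall j, f j != 0 -> j \in s) -> f \in @loop_pred V.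
Proof.
by move=> hs; apply/asboolP; apply: (sub_finite_set _ (finite_seq s)) => j /hs.
Qed.

Lemma loopP f g : (forall j, f j = g j) -> f = g.
Proof. by move=> h; apply/val_inj/funext. Qed.

Lemma loopD f g j : (f + g) j = f j + g j. Proof. by []. Qed.
Lemma loopZ a f j : (a *: f) j = a *: f j. Proof. by []. Qed.
Lemma loop0 j : (0 : loop V) j = 0. Proof. by []. Qed.
Lemma loopN f j : (- f) j = - f j. Proof. by []. Qed.

Fact mono_subproof (i : int) (x : V) :
  (fun j => if j == i then x else 0) \in @loop_pred V.
Proof.
apply: (@loop_predI _ [:: i]) => j; rewrite inE.
by case: (j == i); rewrite ?eqxx.
Qed.

(* The monomial x (x) t^i. *)
Definition mono i x : loop V := Loop (mono_subproof i x).

Lemma monoE i x j : mono i x j = if j == i then x else 0. Proof. by []. Qed.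

Lemma loop_sum f : exists s, f = \sum_(i <- s) mono i (f i).
Proof.
have [s us hs] := loop_seq f; exists s; apply: loopP => j.
rewrite (big_morph (fun h : loop V => h j) (fun h k => loopD h k j) (loop0 j)).
case: (boolP (j \in s)) => hj.
  rewrite (bigD1_seq j) // monoE eqxx big1 => [|i ij]; first by rewrite /= addr0.
  by rewrite monoE eq_sym (negPf ij).
rewrite big_seq big1 => [|i hi]; last first.
  by rewrite monoE; case: eqP hi hj => // ->  ->.
by apply/eqP; apply: contraNT hj => /hs.
Qed.

Lemma loop_ind (P : loop V -> Prop) : P 0 ->
  (forall f g, P f -> P g -> P (f + g)) -> (forall i x, P (mono i x)) ->
  forall f, P f.
Proof.
move=> P0 PD Pm f; have [s ->] := loop_sum f.
by elim/big_ind: _ => // i _; apply: Pm.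
Qed.

(* The derivation t d/dt. *)
Fact ldeg_subproof f : (fun j : int => j%:~R *: f j) \in @loop_pred V.
Proof.
have [s _ hs] := loop_seq f; apply: (@loop_predI _ s) => j hj; apply: hs.
by apply: contraNneq hj => ->; rewrite scaler0.
Qed.
Definition ldeg f : loop V := Loop (ldeg_subproof f).

Lemma ldegE f j : ldeg f j = j%:~R *: f j. Proof. by []. Qed.

Lemma ldeg_mono i x : ldeg (mono i x) = i%:~R *: mono i x.
Proof.
by apply: loopP => j; rewrite ldegE loopZ monoE; case: eqP => [->|] //; rewrite !scaler0.
Qed.

Lemma ldeg_lin a f g : ldeg (a *: f + g) = a *: ldeg f + ldeg g.
Proof.
apply: loopP => j; rewrite ldegE !(loopD, loopZ, ldegE) scalerDr.
by rewrite !scalerA mulrC.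
Qed.

End LoopTheory.

Section Affine.
Variables (F : numFieldType) (L : lieSuperType F).
Implicit Types f g h : loop L.

Fact lbr_subproof f g :
  (fun n => \sum_(i \in [set: int]) br (f i) (g (n - i))) \in @loop_pred L.
Proof.
have [s us hs] := loop_seq f; have [t ut ht] := loop_seq g.
apply: (@loop_predI _ _ _ [seq i + j | i <- s, j <- t]) => n.
apply: contra_neqT => hn; apply: fsbig1 => i _.
case: (eqVneq (f i) 0) => [->|/hs hi]; first by rewrite br0l.
case: (eqVneq (g (n - i)) 0) => [->|/ht hj]; first by rewrite br0r.
by case/allpairsP: hn; exists (i, n - i); split=> //=; rewrite addrC subrK.
Qed.

(* The bracket [x (x) t^i, y (x) t^j] = [x, y] (x) t^(i + j) of L[t, t^-1]. *)
Definition lbr f g : loop L := Loop (lbr_subproof f g).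

Lemma lbrE f g n :
  lbr f g n = \sum_(i \in [set: int]) br (f i) (g (n - i)).
Proof. by []. Qed.

Lemma lbr_seq f g n s : uniq s -> (forall j, f j != 0 -> j \in s) ->
  lbr f g n = \sum_(i <- s) br (f i) (g (n - i)).
Proof.
move=> us hs; rewrite lbrE (fsbigE s) //.
  by apply: eq_bigl => i; rewrite in_setT.
move=> i _ hi; case: (eqVneq (f i) 0) => [->|/hs]; first by rewrite br0l.
by rewrite (negPf hi).
Qed.

Lemma lbr_linl a f g h : lbr (a *: f + g) h = a *: lbr f h + lbr g h.
Proof.
have [s us hs] := loop_seq f; have [t ut ht] := loop_seq g.
pose r := undup (s ++ t).
have hrf j : f j != 0 -> j \in r by move/hs => hj; rewrite mem_undup mem_cat hj.
have hrg j : g j != 0 -> j \in r.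
  by move/ht => hj; rewrite mem_undup mem_cat hj orbT.
apply: loopP => n; rewrite loopD loopZ !(@lbr_seq _ _ n r) ?undup_uniq //.
  by rewrite scaler_sumr -big_split; apply: eq_bigr => i _; rewrite /= br_linl.
move=> j; rewrite loopD loopZ; case: (eqVneq (f j) 0) => [->|/hrf//].
by rewrite scaler0 add0r => /hrg.
Qed.

Lemma lbr_linr a f g h : lbr f (a *: g + h) = a *: lbr f g + lbr f h.
Proof.
have [s us hs] := loop_seq f; apply: loopP => n.
rewrite loopD loopZ !(@lbr_seq _ _ n s) //.
by rewrite scaler_sumr -big_split; apply: eq_bigr => i _; rewrite /= br_linr.
Qed.

Lemma lbr_mono i x j y : lbr (mono i x) (mono j y) = mono (i + j) (br x y).
Proof.
apply: loopP => n; rewrite (@lbr_seq _ _ n [:: i]) //; last first.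
  by move=> k; rewrite monoE inE; case: (k == i); rewrite ?eqxx.
rewrite big_seq1 !monoE eqxx subr_eq addrC.
by case: eqP; rewrite ?br0r.
Qed.

Lemma lbrDl f g h : lbr (f + g) h = lbr f h + lbr g h.
Proof. by rewrite -{1}[f]scale1r lbr_linl scale1r. Qed.
Lemma lbrDr f g h : lbr f (g + h) = lbr f g + lbr f h.
Proof. by rewrite -{1}[g]scale1r lbr_linr scale1r. Qed.
Lemma lbr0l f : lbr 0 f = 0.
Proof. by apply: (addrI (lbr 0 f)); rewrite -lbrDl !addr0. Qed.
Lemma lbr0r f : lbr f 0 = 0.
Proof. by apply: (addrI (lbr f 0)); rewrite -lbrDr !addr0. Qed.
Lemma lbrZl a f g : lbr (a *: f) g = a *: lbr f g.
Proof. by rewrite -[a *: f]addr0 lbr_linl lbr0l addr0. Qed.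
Lemma lbrZr a f g : lbr f (a *: g) = a *: lbr f g.
Proof. by rewrite -[a *: g]addr0 lbr_linr lbr0r addr0. Qed.

Definition lspart p : set (loop L) := [set f | forall j, spart p (f j)].

Lemma spart_sum p (I : Type) (s : seq I) (u : I -> L) :
  (forall i, spart p (u i)) -> spart p (\sum_(i <- s) u i).
Proof.
by move=> hu; elim/big_ind: _ => [|x y|i _ //]; [exact: spart0|exact: spartD].
Qed.

Lemma lbr_spart p q f g : lspart p f -> lspart q g -> lspart (p (+) q) (lbr f g).
Proof.
move=> hf hg n; have [s us hs] := loop_seq f.
by rewrite (@lbr_seq _ _ n s) //; apply: spart_sum => i; apply: br_spart.
Qed.

Lemma lspart_ind p (P : loop L -> Prop) : P 0 ->
  (forall f g, P f -> P g -> P (f + g)) ->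
  (forall i x, spart p x -> P (mono i x)) ->
  forall f, lspart p f -> P f.
Proof.
move=> P0 PD Pm f hf; have [s ->] := loop_sum f.
by elim/big_ind: _ => // i _; apply: Pm.
Qed.

Lemma mono_lin i a (x y : L) : mono i (a *: x + y) = a *: mono i x + mono i y.
Proof.
apply: loopP => j; rewrite loopD loopZ !monoE.
by case: eqP; rewrite // scaler0 addr0.
Qed.
Lemma monoD i (x y : L) : mono i (x + y) = mono i x + mono i y.
Proof. by rewrite -{1}[x]scale1r mono_lin scale1r. Qed.
Lemma mono0 i : mono i (0 : L) = 0.
Proof. by apply: (addrI (mono i 0)); rewrite -monoD !addr0. Qed.
Lemma monoZ i a (x : L) : mono i (a *: x) = a *: mono i x.
Proof. by rewrite -[a *: x]addr0 mono_lin mono0 addr0. Qed.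
Lemma monoN i (x : L) : mono i (- x) = - mono i x.
Proof. by rewrite -scaleN1r monoZ scaleN1r. Qed.

Lemma lbr_anti p q f g : lspart p f -> lspart q g ->
  lbr f g = - ((-1) ^+ (p && q) *: lbr g f).
Proof.
move=> hf hg; move: f hf; apply: lspart_ind => [|f f' hf hf'|i x hx].
- by rewrite lbr0l lbr0r scaler0 oppr0.
- by rewrite lbrDl lbrDr hf hf' scalerDr opprD.
move: g hg; apply: lspart_ind => [|f f' hf hf'|j y hy].
- by rewrite lbr0l lbr0r scaler0 oppr0.
- by rewrite lbrDl lbrDr hf hf' scalerDr opprD.
by rewrite !lbr_mono (br_anti _ _ _ _ hx hy) monoN monoZ addrC.
Qed.

Lemma lbr_jacobi p q r f g h : lspart p f -> lspart q g -> lspart r h ->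
  lbr f (lbr g h) = lbr (lbr f g) h + (-1) ^+ (p && q) *: lbr g (lbr f h).
Proof.
move=> hf hg hh; move: f hf; apply: lspart_ind => [|f f' hf hf'|i x hx].
- by rewrite !(lbr0l, lbr0r) scaler0 addr0.
- by rewrite !(lbrDl, lbrDr) hf hf' scalerDr addrACA.
move: g hg; apply: lspart_ind => [|f f' hf hf'|j y hy].
- by rewrite !(lbr0l, lbr0r) scaler0 addr0.
- by rewrite !(lbrDl, lbrDr) hf hf' scalerDr addrACA.
move: h hh; apply: lspart_ind => [|f f' hf hf'|k z hz].
- by rewrite !(lbr0l, lbr0r) scaler0 addr0.
- by rewrite !(lbrDl, lbrDr) hf hf' scalerDr addrACA.
rewrite !lbr_mono (br_jacobi _ _ _ _ _ _ hx hy hz) monoD monoZ.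
by rewrite addrA [j + (i + k)]addrCA addrA.
Qed.

Lemma ldeg_lbr f g : ldeg (lbr f g) = lbr (ldeg f) g + lbr f (ldeg g).
Proof.
have ldegD u v : ldeg (u + v) = ldeg u + ldeg v :> loop L.
  by rewrite -{1}[u]scale1r ldeg_lin scale1r.
have ldeg0 : ldeg 0 = 0 :> loop L.
  by apply: (addrI (ldeg 0)); rewrite -ldegD !addr0.
elim/loop_ind: f => [|f f' hf hf'|i x].
- by rewrite ldeg0 !lbr0l ldeg0 addr0.
- by rewrite !(lbrDl, ldegD) hf hf' addrACA.
elim/loop_ind: g => [|f f' hf hf'|j y].
- by rewrite ldeg0 !lbr0r ldeg0 addr0.
- by rewrite !(lbrDr, ldegD) hf hf' addrACA.
by rewrite lbr_mono !ldeg_mono lbrZl lbrZr lbr_mono -scalerDl intrD.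
Qed.

Lemma ldeg_spart p f : lspart p f -> lspart p (ldeg f).
Proof. by move=> hf j; apply: spartZ. Qed.

Variable B : invForm L.

Definition lform f g : F := \sum_(i \in [set: int]) B (f i) (g (- i)).

Lemma lform_seq f g s : uniq s -> (forall j, f j != 0 -> j \in s) ->
  lform f g = \sum_(i <- s) B (f i) (g (- i)).
Proof.
move=> us hs; rewrite /lform (fsbigE s) //.
  by apply: eq_bigl => i; rewrite in_setT.
move=> i _ hi; case: (eqVneq (f i) 0) => [->|/hs]; first by rewrite bform0l.
by rewrite (negPf hi).
Qed.

Lemma lform_linl a f g h : lform (a *: f + g) h = a * lform f h + lform g h.
Proof.
have [s us hs] := loop_seq f; have [t ut ht] := loop_seq g.
pose r := undup (s ++ t).
have hrf j : f j != 0 -> j \in r by move/hs => hj; rewrite mem_undup mem_cat hj.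
have hrg j : g j != 0 -> j \in r.
  by move/ht => hj; rewrite mem_undup mem_cat hj orbT.
rewrite !(@lform_seq _ _ r) ?undup_uniq //.
  rewrite mulr_sumr -big_split; apply: eq_bigr => i _.
  by rewrite /= bform_linl.
move=> j; rewrite loopD loopZ; case: (eqVneq (f j) 0) => [->|/hrf//].
by rewrite scaler0 add0r => /hrg.
Qed.

Lemma lform_linr a f g h : lform f (a *: g + h) = a * lform f g + lform f h.
Proof.
have [s us hs] := loop_seq f; rewrite !(@lform_seq _ _ s) //.
rewrite mulr_sumr -big_split; apply: eq_bigr => i _.
by rewrite /= bform_linr.
Qed.

Lemma lform_mono i x j y :
  lform (mono i x) (mono j y) = if i + j == 0 then B x y else 0.
Proof.
rewrite (@lform_seq _ _ [:: i]) //; last first.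
  by move=> k; rewrite monoE inE; case: (k == i); rewrite ?eqxx.
rewrite big_seq1 !monoE eqxx.
have -> : (- i == j) = (i + j == 0) by rewrite eq_sym addrC addr_eq0.
by case: (_ == 0); rewrite ?bform0r.
Qed.

Lemma lformDl f g h : lform (f + g) h = lform f h + lform g h.
Proof. by rewrite -{1}[f]scale1r lform_linl mul1r. Qed.
Lemma lformDr f g h : lform f (g + h) = lform f g + lform f h.
Proof. by rewrite -{1}[g]scale1r lform_linr mul1r. Qed.
Lemma lform0l f : lform 0 f = 0.
Proof. by apply: (addrI (lform 0 f)); rewrite -lformDl !addr0. Qed.
Lemma lform0r f : lform f 0 = 0.
Proof. by apply: (addrI (lform f 0)); rewrite -lformDr !addr0. Qed.
Lemma lformZl a f g : lform (a *: f) g = a * lform f g.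
Proof. by rewrite -[a *: f]addr0 lform_linl lform0l addr0. Qed.
Lemma lformZr a f g : lform f (a *: g) = a * lform f g.
Proof. by rewrite -[a *: g]addr0 lform_linr lform0r addr0. Qed.

Lemma ldegD f g : ldeg (f + g) = ldeg f + ldeg g.
Proof. by rewrite -{1}[f]scale1r ldeg_lin scale1r. Qed.
Lemma ldeg0 : ldeg (0 : loop L) = 0.
Proof. by apply: (addrI (ldeg 0)); rewrite -ldegD !addr0. Qed.
Lemma ldegZ a f : ldeg (a *: f) = a *: ldeg f.
Proof. by rewrite -[a *: f]addr0 ldeg_lin ldeg0 addr0. Qed.
Lemma ldegN f : ldeg (- f) = - ldeg f.
Proof. by rewrite -scaleN1r ldegZ scaleN1r. Qed.

Lemma lform_inv f g h : lform (lbr f g) h = lform f (lbr g h).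
Proof.
elim/loop_ind: f => [|f f' hf hf'|i x].
- by rewrite lbr0l !lform0l.
- by rewrite !(lbrDl, lformDl) hf hf'.
elim/loop_ind: g => [|f f' hf hf'|j y].
- by rewrite lbr0l lbr0r !lform0l lform0r.
- by rewrite !(lbrDl, lbrDr, lformDl, lformDr) hf hf'.
elim/loop_ind: h => [|f f' hf hf'|k z].
- by rewrite lbr0r !lform0r.
- by rewrite !(lbrDr, lformDr) hf hf'.
by rewrite !lbr_mono !lform_mono addrA bform_inv.
Qed.

Lemma lform_ldeg f g : lform (ldeg f) g = - lform f (ldeg g).
Proof.
elim/loop_ind: f => [|f f' hf hf'|i x].
- by rewrite ldeg0 !lform0l oppr0.
- by rewrite !(ldegD, lformDl) hf hf' opprD.
elim/loop_ind: g => [|f f' hf hf'|j y].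
- by rewrite ldeg0 !lform0r oppr0.
- by rewrite !(ldegD, lformDr) hf hf' opprD.
rewrite !ldeg_mono lformZl lformZr lform_mono.
case: eqP => [/eqP|_]; last by rewrite !mulr0 oppr0.
by rewrite addr_eq0 => /eqP ->; rewrite mulrNz mulNr.
Qed.

Lemma lform_sym p q f g : lspart p f -> lspart q g ->
  lform f g = (-1) ^+ (p && q) * lform g f.
Proof.
move=> hf hg; move: f hf; apply: lspart_ind => [|f f' hf hf'|i x hx].
- by rewrite lform0l lform0r mulr0.
- by rewrite lformDl lformDr hf hf' mulrDr.
move: g hg; apply: lspart_ind => [|f f' hf hf'|j y hy].
- by rewrite lform0l lform0r mulr0.
- by rewrite lformDl lformDr hf hf' mulrDr.
rewrite !lform_mono [j + i]addrC; case: eqP; rewrite ?mulr0 // => _.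
exact: bform_supersym.
Qed.

Lemma lform_even p q f g : lspart p f -> lspart q g -> p (+) q ->
  lform f g = 0.
Proof.
have wl u v : lspart false u -> lspart true v -> lform u v = 0.
  by move=> hu hv; apply: fsbig1 => i _; apply: bform_even.
case: p q => [] [] // hf hg _; last exact: wl.
by rewrite (lform_sym hf hg) wl ?mulr0.
Qed.

(* Coefficient of K in the bracket of two loops. *)
Definition lcocycle f g : F :=
  \sum_(i \in [set: int]) i%:~R * B (f i) (g (- i)).

Lemma lcocycleE f g : lcocycle f g = lform (ldeg f) g.
Proof.
by rewrite /lcocycle; apply: eq_fsbigr => i _; rewrite ldegE bformZl.
Qed.

End Affine.

(* (f, a, b) stands for f + a K + b d. *)
Definition affine (F : numFieldType) (L : lieSuperType F) (B : invForm L) :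
  Type := (loop L * F^o * F^o)%type.

Section AffineInst.
Variables (F : numFieldType) (L : lieSuperType F) (B : invForm L).
Local Notation A := (affine B).
Implicit Types X Y Z : A.

HB.instance Definition _ := GRing.Lmodule.copy A (loop L * F^o * F^o)%type.

Definition aloop X : loop L := X.1.1.
Definition acK X : F := X.1.2.
Definition acd X : F := X.2.

Lemma affineP X Y : aloop X = aloop Y -> acK X = acK Y -> acd X = acd Y -> X = Y.
Proof.
by case: X => [[f a] b]; case: Y => [[g c] d]; rewrite /aloop /acK /acd /= => -> -> ->.
Qed.

Lemma aloop_lin a X Y : aloop (a *: X + Y) = a *: aloop X + aloop Y.
Proof. by []. Qed.
Lemma acK_lin a X Y : acK (a *: X + Y) = a * acK X + acK Y.
Proof. by []. Qed.
Lemma acd_lin a X Y : acd (a *: X + Y) = a * acd X + acd Y.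
Proof. by []. Qed.

Definition aspart p : set A :=
  [set X | lspart p (aloop X) /\ (p -> acK X = 0 /\ acd X = 0)].

Definition abr X Y : A :=
  (lbr (aloop X) (aloop Y)
     + acd X *: ldeg (aloop Y) - acd Y *: ldeg (aloop X),
   lcocycle B (aloop X) (aloop Y), 0).

Lemma aloop_br X Y : aloop (abr X Y) = lbr (aloop X) (aloop Y)
     + acd X *: ldeg (aloop Y) - acd Y *: ldeg (aloop X).
Proof. by []. Qed.
Lemma acK_br X Y : acK (abr X Y) = lform B (ldeg (aloop X)) (aloop Y).
Proof. exact: lcocycleE. Qed.
Lemma acd_br X Y : acd (abr X Y) = 0. Proof. by []. Qed.

Fact aspart_lin p a X Y : aspart p X -> aspart p Y -> aspart p (a *: X + Y).
Proof.
move=> [hX eX] [hY eY]; split.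
  by move=> j; rewrite aloop_lin loopD loopZ; apply: spart_lin.
move=> hp; rewrite acK_lin acd_lin; have [-> ->] := eX hp.
by have [-> ->] := eY hp; rewrite mulr0 addr0.
Qed.

Fact lspart_split (f : loop L) :
  exists f0 f1, [/\ lspart false f0, lspart true f1 & f = f0 + f1].
Proof.
elim/loop_ind: f => [|f g [f0 [f1 [hf0 hf1 ->]]] [g0 [g1 [hg0 hg1 ->]]]|i x].
- by exists 0, 0; split; rewrite ?addr0 // => j; apply: spart0.
- exists (f0 + g0), (f1 + g1); split; last by rewrite addrACA.
  + by move=> j; exact: spartD (hf0 j) (hg0 j).
  + by move=> j; exact: spartD (hf1 j) (hg1 j).
have [x0 [x1 [h0 h1 ->]]] := spart_split x.
exists (mono i x0), (mono i x1); split; last by rewrite monoD.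
- by move=> j; rewrite monoE; case: eqP => // _; apply: spart0.
- by move=> j; rewrite monoE; case: eqP => // _; apply: spart0.
Qed.

Fact aspart_split X :
  exists X0 X1, [/\ aspart false X0, aspart true X1 & X = X0 + X1].
Proof.
case: X => [[f a] b]; have [f0 [f1 [h0 h1 ->]]] := lspart_split f.
exists (f0, a, b), (f1, 0, 0); split=> //.
apply: affineP => //; first by rewrite /acK /= addr0.
by rewrite /acd /= addr0.
Qed.

Fact aspart_cap X : aspart false X -> aspart true X -> X = 0.
Proof.
move=> [h0 _] [h1 /(_ isT) [hK hd]]; apply: affineP => //.
by apply: loopP => j; apply: spart_cap.
Qed.

Fact addr6ACA (V : zmodType) (x x' y y' z z' : V) :
  x + x' + (y + y') - (z + z') = x + y - z + (x' + y' - z').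
Proof. by rewrite [x + x' + _]addrACA opprD [LHS]addrACA. Qed.

Fact abr_linl a X Y Z : abr (a *: X + Y) Z = a *: abr X Z + abr Y Z.
Proof.
apply: affineP.
- rewrite aloop_lin !aloop_br aloop_lin acd_lin lbr_linl ldeg_lin.
  rewrite scalerDl !scalerDr !scalerN !scalerA [acd Z * a]mulrC.
  exact: addr6ACA.
- by rewrite acK_lin !acK_br aloop_lin ldeg_lin lform_linl.
- by rewrite acd_lin !acd_br mulr0 addr0.
Qed.

Fact abr_linr a X Y Z : abr X (a *: Y + Z) = a *: abr X Y + abr X Z.
Proof.
apply: affineP.
- rewrite aloop_lin !aloop_br aloop_lin acd_lin lbr_linr ldeg_lin.
  rewrite scalerDl !scalerDr !scalerN !scalerA [acd X * a]mulrC.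
  exact: addr6ACA.
- by rewrite acK_lin !acK_br aloop_lin lform_linr.
- by rewrite acd_lin !acd_br mulr0 addr0.
Qed.

Fact abr_spart p q X Y : aspart p X -> aspart q Y -> aspart (p (+) q) (abr X Y).
Proof.
move=> [hX eX] [hY eY]; split; last first.
  move=> pq; split; last by [].
  by rewrite acK_br (lform_even B _ hY pq) //; apply: ldeg_spart.
move=> j; rewrite aloop_br !loopD loopN !loopZ; apply: spartB; last first.
  case: q eY hY => [/(_ isT)[_ ->] _|_ _].
    by rewrite scale0r; apply: spart0.
  by rewrite addbF; apply/spartZ/(ldeg_spart hX).
apply: spartD; first exact: lbr_spart.
case: p eX hX => [/(_ isT)[_ ->] _|_ _].
  by rewrite scale0r; apply: spart0.
by apply/spartZ/(ldeg_spart hY).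
Qed.

Fact abr_anti p q X Y : aspart p X -> aspart q Y ->
  abr X Y = - ((-1) ^+ (p && q) *: abr Y X).
Proof.
move=> [hX eX] [hY eY]; rewrite -scaleNr -[_ *: _]addr0; apply: affineP.
- rewrite aloop_lin !aloop_br (lbr_anti hX hY) addr0 -!addrA scalerDr scaleNr.
  congr (_ + _).
  case: p q eX eY hX hY => [] [] eX eY _ _ /=; rewrite ?scaleN1r ?scale1r.
  + have [_ ->] := eX isT; have [_ ->] := eY isT.
    by rewrite !scale0r oppr0 !addr0 scaler0.
  + by have [_ ->] := eX isT; rewrite !scale0r oppr0 add0r addr0.
  + by have [_ ->] := eY isT; rewrite !scale0r oppr0 addr0 add0r opprK.
  + by rewrite opprB addrC.
- rewrite acK_lin addr0 !acK_br lform_ldeg (lform_sym B hX (ldeg_spart hY)).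
  by rewrite mulNr.
- by rewrite acd_lin !acd_br mulr0 addr0.
Qed.

Fact jacobi_zmod (V : zmodType) (q1 q2 a c d1 d2 e g h i j : V) :
  q1 + q2 + a - c + (d1 + d2 + e - g) =
  q1 + d1 - h - (i + c + g - j) + (q2 + d2 + i + (h + a + e - j)).
Proof.
rewrite !opprD !opprK !addrA.
rewrite [RHS](ACl (1*8*12*5*2*9*13*6*(3*11)*(4*10)*(7*14))) /=.
by rewrite !addNr subrr !addr0.
Qed.

Fact abr_jacobi p q r X Y Z : aspart p X -> aspart q Y -> aspart r Z ->
  abr X (abr Y Z) = abr (abr X Y) Z + (-1) ^+ (p && q) *: abr Y (abr X Z).
Proof.
move=> [hX eX] [hY eY] [hZ _].
have jac := lbr_jacobi hX hY hZ.
have anti := lbr_anti (ldeg_spart hX) hY.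
have sym := lform_sym B (ldeg_spart hX) (ldeg_spart hY).
have anti' := lbr_anti hX (ldeg_spart hY).
have sX : (-1) ^+ (p && q) * acd X = acd X.
  case: p eX {hX jac anti anti' sym} => [/(_ isT)[_ ->]|_]; last by rewrite mul1r.
  by rewrite mulr0.
have sY : (-1) ^+ (p && q) * acd Y = acd Y.
  rewrite andbC; case: q eY {hY jac anti anti' sym sX} => [/(_ isT)[_ ->]|_].
    by rewrite mulr0.
  by rewrite mul1r.
move: sX sY jac anti anti' sym; set s := _ ^+ _ => sX sY jac anti anti' sym.
have lbrNl (f g : loop L) : lbr (- f) g = - lbr f g.
  by rewrite -scaleN1r lbrZl scaleN1r.
have lbrNr (f g : loop L) : lbr f (- g) = - lbr f g.
  by rewrite -scaleN1r lbrZr scaleN1r.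
have lformNl (f g : loop L) : lform B (- f) g = - lform B f g.
  by rewrite -scaleN1r lformZl mulN1r.
have lformNr (f g : loop L) : lform B f (- g) = - lform B f g.
  by rewrite -scaleN1r lformZr mulN1r.
pose lin := (lbrDl, lbrDr, lbrNl, lbrNr, lbrZl, lbrZr, ldegD, ldegN, ldegZ,
  ldeg_lbr).
apply: affineP.
- rewrite addrC aloop_lin addrC !aloop_br !acd_br !scale0r ?addr0 ?subr0.
  rewrite !lin jac !(scalerDr, scalerN) !scalerA.
  rewrite sX [s * acd Z]mulrC -[(acd Z * s) *: _]scalerA -[s *: lbr _ (ldeg _)]opprK.
  rewrite -anti scalerN opprK sY.
  rewrite [acd Z * acd X]mulrC [acd Z * acd Y]mulrC [acd Y * acd X]mulrC.
  exact: jacobi_zmod.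
- rewrite addrC acK_lin addrC !acK_br !aloop_br.
  rewrite !lin !(lformDl, lformDr, lformNl, lformNr, lformZl, lformZr).
  rewrite anti' lformNl lformZl !lform_inv !(lform_ldeg _ (ldeg _)) sym.
  rewrite !(mulrDr, mulrN) !mulrA sX [s * acd Z]mulrC !opprK.
  rewrite !addrA [RHS](ACl (1*4*7*(2*5)*(3*6))) /=.
  by rewrite !addNr !addr0.
- by rewrite addrC acd_lin !acd_br mulr0 addr0.
Qed.

HB.instance Definition _ := isLieSuper.Build F A aspart_lin aspart_split
  aspart_cap abr_linl abr_linr abr_spart abr_anti abr_jacobi.

End AffineInst.

(* Eigenspace of sigma for the eigenvalue (-1)^j. *)
Definition sgeigen (F : numFieldType) (L : lieSuperType F) (sigma : lsAut L)
    (j : int) : set L :=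
  [set x | sigma x = (-1) ^+ `|j|%N *: x].

Definition twisted_pred (F : numFieldType) (L : lieSuperType F)
    (B : invForm L) (sigma : lsAut L) : {pred affine B} :=
  [pred X : affine B | `[< forall j, sgeigen sigma j (aloop X j) >]].
Arguments twisted_pred {F L} B sigma.

(* \bigoplus_j L_(j mod 2) (x) t^j + F K + F d inside the affinization; it is
   the twisted affinization when sigma is an involution. *)
Record twisted (F : numFieldType) (L : lieSuperType F) (B : invForm L)
    (sigma : lsAut L) := Twisted {
  twval : affine B;
  _ : twval \in twisted_pred B sigma
}.

Section TwistedInst.
Variables (F : numFieldType) (L : lieSuperType F) (B : invForm L).
Variable sigma : lsAut L.
Local Notation tw := (twisted B sigma).
Implicit Types X Y Z : affine B.

HB.instance Definition _ := [isSub of tw for @twval F L B sigma].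
HB.instance Definition _ := [Choice of tw by <:].

Lemma sgeigen_lin j a (x y : L) : sgeigen sigma j x -> sgeigen sigma j y ->
  sgeigen sigma j (a *: x + y).
Proof.
rewrite /sgeigen /= linearP => -> ->.
by rewrite scalerDr !scalerA mulrC.
Qed.

Lemma sgeigen0 j : sgeigen sigma j (0 : L).
Proof. by rewrite /sgeigen /= linear0 scaler0. Qed.

Lemma signz (j : int) : (-1) ^+ `|j|%N = (-1) ^ j :> F.
Proof.
case: j => n //; rewrite NegzE abszN absz_nat -invr_expz -exprnP.
by rewrite -signr_odd invr_sign.
Qed.

Lemma sgeigen_br i j x y : sgeigen sigma i x -> sgeigen sigma j y ->
  sgeigen sigma (i + j) (br x y).
Proof.
rewrite /sgeigen /= lsaut_br => -> ->; rewrite brZl brZr scalerA.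
by rewrite !signz expfzDr ?oppr_eq0 ?oner_eq0.
Qed.

Lemma sgeigen_split j x0 x1 : spart false x0 -> spart true x1 ->
  sgeigen sigma j (x0 + x1) -> sgeigen sigma j x0 /\ sgeigen sigma j x1.
Proof.
rewrite /sgeigen /= linearD scalerDr => h0 h1 /eqP.
rewrite -subr_eq0 opprD addrACA addr_eq0 => /eqP e.
have h0' : spart false (sigma x0 - (-1) ^+ `|j|%N *: x0).
  by apply: spartB; [exact: lsaut_spart|exact: spartZ].
have h1' : spart true (sigma x1 - (-1) ^+ `|j|%N *: x1).
  by apply: spartB; [exact: lsaut_spart|exact: spartZ].
have e0 : sigma x0 - (-1) ^+ `|j|%N *: x0 = 0.
  apply: spart_cap => //; rewrite e -scaleN1r; exact: spartZ.
split; apply/eqP; rewrite -subr_eq0; first by rewrite e0.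
by move/eqP: e; rewrite e0 eq_sym oppr_eq0.
Qed.

Lemma twP X : reflect (forall j, sgeigen sigma j (aloop X j))
  (X \in twisted_pred B sigma).
Proof. exact: asboolP. Qed.

Fact tw_submod_closed : submod_closed (twisted_pred B sigma).
Proof.
split=> [|a X Y /twP hX /twP hY]; apply/twP => j; first exact: sgeigen0.
by rewrite aloop_lin loopD loopZ; apply: sgeigen_lin.
Qed.
HB.instance Definition _ := GRing.isSubmodClosed.Build F (affine B)
  (twisted_pred B sigma) tw_submod_closed.
HB.instance Definition _ := [SubChoice_isSubLmodule of tw by <:].

Fact tw_br_closed X Y : X \in twisted_pred B sigma ->
  Y \in twisted_pred B sigma -> br X Y \in twisted_pred B sigma.
Proof.
move=> /twP hX /twP hY; apply/twP => j.
have hD U : (forall j, sgeigen sigma j (aloop U j)) ->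
    sgeigen sigma j (ldeg (aloop U) j).
  move=> hU; rewrite ldegE -[_ *: _]addr0.
  by apply: sgeigen_lin => //; apply: sgeigen0.
rewrite [br X Y]/(abr X Y) aloop_br !loopD loopN !loopZ -scaleNr addrC.
apply: sgeigen_lin; first exact: hD.
rewrite addrC; apply: sgeigen_lin; first exact: hD.
have [s us hs] := loop_seq (aloop X).
rewrite (@lbr_seq _ _ _ _ _ s) //.
elim/big_ind: _ => [|x y hx hy|i _]; first exact: sgeigen0.
  by rewrite -[x]scale1r; apply: sgeigen_lin.
by have := sgeigen_br (hX i) (hY (j - i)); rewrite addrC subrK.
Qed.

Definition twspart p : set tw := [set X | spart p (twval X)].
Definition twbr (X Y : tw) : tw := Twisted (tw_br_closed (valP X) (valP Y)).

Fact twspart_lin p a (X Y : tw) :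
  twspart p X -> twspart p Y -> twspart p (a *: X + Y).
Proof. exact: spart_lin. Qed.

Fact twspart_split (X : tw) :
  exists X0 X1 : tw, [/\ twspart false X0, twspart true X1 & X = X0 + X1].
Proof.
have [X0 [X1 [h0 h1 e]]] := spart_split (val X).
have hj j : sgeigen sigma j (aloop X0 j) /\ sgeigen sigma j (aloop X1 j).
  apply: sgeigen_split; [exact: h0.1|exact: h1.1|].
  by have /twP/(_ j) := valP X; rewrite e.
have t0 : X0 \in twisted_pred B sigma by apply/twP => j; case: (hj j).
have t1 : X1 \in twisted_pred B sigma by apply/twP => j; case: (hj j).
by exists (Twisted t0), (Twisted t1); split=> //; apply: val_inj.
Qed.

Fact twspart_cap (X : tw) : twspart false X -> twspart true X -> X = 0.
Proof. by move=> h0 h1; apply: val_inj; apply: spart_cap. Qed.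

Fact twbr_linl a (X Y Z : tw) :
  twbr (a *: X + Y) Z = a *: twbr X Z + twbr Y Z.
Proof. by apply: val_inj; apply: br_linl. Qed.

Fact twbr_linr a (X Y Z : tw) :
  twbr X (a *: Y + Z) = a *: twbr X Y + twbr X Z.
Proof. by apply: val_inj; apply: br_linr. Qed.

Fact twbr_spart p q (X Y : tw) :
  twspart p X -> twspart q Y -> twspart (p (+) q) (twbr X Y).
Proof. exact: br_spart. Qed.

Fact twbr_anti p q (X Y : tw) : twspart p X -> twspart q Y ->
  twbr X Y = - ((-1) ^+ (p && q) *: twbr Y X).
Proof. by move=> hX hY; apply: val_inj; apply: br_anti. Qed.

Fact twbr_jacobi p q r (X Y Z : tw) :
  twspart p X -> twspart q Y -> twspart r Z ->
  twbr X (twbr Y Z)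
  = twbr (twbr X Y) Z + (-1) ^+ (p && q) *: twbr Y (twbr X Z).
Proof.
by move=> hX hY hZ; apply: val_inj; apply: br_jacobi hX hY hZ.
Qed.

HB.instance Definition _ := isLieSuper.Build F tw twspart_lin twspart_split
  twspart_cap twbr_linl twbr_linr twbr_spart twbr_anti twbr_jacobi.

End TwistedInst.

(* Structure constants of the imaginary octonions: for indices mod 7 and
   d = 1, 2, 4, e_i e_(i + d) = - e_(i + d) e_i = e_(i + 3 d). *)
Definition octc (F : numFieldType) (i j k : 'Z_7) : F :=
  if (j - i \in [:: 1; 2; 4]) && (k == i + 3 * (j - i)) then 1
  else if (i - j \in [:: 1; 2; 4]) && (k == j + 3 * (i - j)) then -1
  else 0.

Definition octcross (F : numFieldType) (u v : 'cV[F]_7) : 'cV[F]_7 :=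
  \col_k \sum_i \sum_j octc F i j k * u i 0 * v j 0.

(* G_2 as the derivation algebra of the octonions, acting on the imaginary
   ones. *)
Definition G2_set (F : numFieldType) : set 'M[F]_7 :=
  [set D | forall u v : 'cV[F]_7,
     D *m octcross u v = octcross (D *m u) v + octcross u (D *m v)].
Arguments G2_set F : clear implicits.

Definition sl2_set (F : numFieldType) : set 'M[F]_2 := [set M | \tr M = 0].
Arguments sl2_set F : clear implicits.

Section G3.
Variables (F : numFieldType) (L : finLieSuperType F).

Definition even_part_G2_sl2 : Prop :=
  exists phi : {linear L -> ('M[F]_7 * 'M[F]_2)%type},
    set_bij (spart false) (G2_set F `*` sl2_set F) phi /\
    forall x y : L, spart false x -> spart false y ->
      phi (br x y)
      = ((phi x).1 *m (phi y).1 - (phi y).1 *m (phi x).1,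
         (phi x).2 *m (phi y).2 - (phi y).2 *m (phi x).2).

Definition graded_ideal (I : {vspace L}) : Prop :=
  (forall x y, y \in I -> br x y \in I) /\
  (forall x0 x1, spart false x0 -> spart true x1 ->
     x0 + x1 \in I -> x0 \in I /\ x1 \in I).

Definition simple_ls : Prop :=
  (exists x y : L, br x y != 0) /\
  (forall I : {vspace L}, graded_ideal I -> I = 0%VS \/ I = fullv).

(* The simple Lie superalgebra of dimension 31 with even part G_2 x sl_2; the
   form making it basic is a separate datum of type [invForm L]. *)
Definition is_G3 : Prop :=
  [/\ simple_ls, \dim {: L} = 31 & even_part_G2_sl2].

Definition ad_diagonalizable (h : L) : Prop :=
  exists2 e : seq L, basis_of fullv e &
    forall x, x \in e -> exists c : F, br h x = c *: x.

(* Cartan subalgebra of the even part: maximal abelian, acting semisimply. *)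
Definition cartan_subalg (H : {vspace L}) : Prop :=
  [/\ forall h, h \in H -> spart false h,
      forall h h', h \in H -> h' \in H -> br h h' = 0,
      forall x, spart false x -> (forall h, h \in H -> br h x = 0) -> x \in H
    & forall h, h \in H -> ad_diagonalizable h].

Definition is_root (H : {vspace L}) (a : 'Hom(subvs_of H, F^o)) : Prop :=
  a != 0 /\
  exists2 x : L, x != 0 & forall h : subvs_of H, br (vsval h) x = a h *: x.

Definition simple_roots (H : {vspace L})
    (alpha : 3.-tuple 'Hom(subvs_of H, F^o)) : Prop :=
  [/\ free alpha,
      forall i, is_root (tnth alpha i)
    & forall b, is_root b ->
        exists n : 'I_3 -> nat,
          b = \sum_i tnth alpha i *+ n i \/ b = - \sum_i tnth alpha i *+ n i].

End G3.

(* sigma is exp (ad h), i.e. the pointwise sum of the series (ad h)^k / k!,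
   in the coordinates of L. *)
Definition is_exp_ad (R : realType) (L : finLieSuperType R[i]) (h : L)
    (sigma : L -> L) : Prop :=
  forall (x : L) (i : 'I_(\dim {: L})),
    (fun n => coord (vbasis {: L}) i
                (\sum_(k < n) (k`!%:R)^-1 *: iter k (br h) x) : R[i]^o) @ \oo
    --> (coord (vbasis {: L}) i (sigma x) : R[i]^o).

(* Main.v *)
(* Put u = h0 / (pi i).  Every eigenvalue of ad u is an integer: an eigenvector
   refines to a common eigenvector of ad h, whose weight is 0 or a root, hence
   an integral combination of the simple roots, and only the first of them is
   nonzero on u.  So exp(ad h0) acts as (-1)^n on the u-eigenspace of
   eigenvalue n, and since u is inner the twist is undone by the spectral flow
     x (x) t^i |-> x (x) t^(2 i + n) + delta_(i, 0) (u, x) K,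
     K |-> 2 K,   d |-> (d - u) / 2     (x of u-eigenvalue n). *)
From HB Require Import structures.
Require Import Defs.
From mathcomp Require Import all_boot all_order all_algebra.
From mathcomp Require Import complex.
From mathcomp Require Import all_classical all_reals all_analysis.

Set Implicit Arguments.
Unset Strict Implicit.
Unset Printing Implicit Defensive.

Import Order.TTheory GRing.Theory Num.Theory numFieldNormedType.Exports.
Local Open Scope classical_set_scope.
Local Open Scope ring_scope.

(** For even [z] the Jacobi sign is trivial, so [br z] is a derivation on all elements, homogeneous
    or not. *)
Lemma br_even_leibniz (F : numFieldType) (L : lieSuperType F) (z x y : L) :
  spart false z -> br z (br x y) = br (br z x) y + br x (br z y).
Proof.
move=> hz; have [x0 [x1 [hx0 hx1 ->]]] := spart_split x.
have [y0 [y1 [hy0 hy1 ->]]] := spart_split y.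
have leib p q v t : spart p v -> spart q t ->
    br z (br v t) = br (br z v) t + br v (br z t).
  by move=> hv ht; rewrite (br_jacobi _ _ _ _ _ _ hz hv ht) scale1r.
rewrite !(brDl, brDr) (leib _ _ _ _ hx0 hy0) (leib _ _ _ _ hx0 hy1).
rewrite (leib _ _ _ _ hx1 hy0) (leib _ _ _ _ hx1 hy1).
by rewrite [LHS](AC ((2*2)*(2*2)) ((1*5*(3*7))*(2*4*(6*8)))).
Qed.

(** * Weight decomposition under an even element with integer eigenvalues *)

Section WeightDecomposition.
Variables (F : numFieldType) (L : finLieSuperType F) (B : invForm L) (u : L).
Variables (m : nat) (e : m.-tuple L) (w : 'I_m -> int).
Hypothesis e_basis : basis_of fullv e.
Hypothesis u_even : spart false u.
Hypothesis e_weight : forall k, br u (tnth e k) = (w k)%:~R *: tnth e k.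
Implicit Types (x y : L) (n i j : int) (f g : loop L).

Definition weight n x := br u x = n%:~R *: x.

(** Projection onto one eigenspace of [br u] along the others, in the eigenbasis [e]. *)
Definition wproj n x : L := \sum_(k | w k == n) coord e k x *: tnth e k.

Definition weights : seq int := undup (codom w).

Lemma wproj_lin n a x y : wproj n (a *: x + y) = a *: wproj n x + wproj n y.
Proof.
rewrite scaler_sumr -big_split; apply: eq_bigr => k _ /=.
by rewrite linearP scalerDl scalerA.
Qed.

HB.instance Definition _ n :=
  GRing.isLinear.Build F L L *:%R (wproj n) (wproj_lin n).

Lemma br_sumr x (I : Type) (s : seq I) (P : pred I) (y : I -> L) :
  br x (\sum_(i <- s | P i) y i) = \sum_(i <- s | P i) br x (y i).
Proof. by apply: (big_morph (br x) (brDr x) (br0r x)). Qed.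

Lemma weight_wproj n x : weight n (wproj n x).
Proof.
rewrite /weight /wproj br_sumr scaler_sumr; apply: eq_bigr => k /eqP wk.
by rewrite brZr e_weight wk !scalerA mulrC.
Qed.

Lemma sum_wproj x : \sum_(n <- weights) wproj n x = x.
Proof.
rewrite [RHS](coord_basis e_basis (memvf x)).
under [RHS]eq_bigr do rewrite -tnth_nth.
rewrite /wproj (exchange_big_dep xpredT) //=; apply: eq_bigr => k _.
have wk : w k \in weights by rewrite mem_undup codom_f.
rewrite big_mkcond (bigD1_seq (w k)) ?undup_uniq //= eqxx big1 ?addr0 // => n.
by rewrite eq_sym => /negPf ->.
Qed.

Lemma wproj_id k n : wproj n (tnth e k) = if w k == n then tnth e k else 0.
Proof.
have ek l : coord e l (tnth e k) = (k == l)%:R.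
  by rewrite (tnth_nth 0) coord_free ?(basis_free e_basis) // eq_sym.
rewrite /wproj; case: ifP => wk.
  rewrite (bigD1 k) //= ek eqxx scale1r big1 ?addr0 // => l /andP[_].
  by rewrite ek eq_sym => /negPf ->; rewrite scale0r.
rewrite big1 // => l wl; rewrite ek; case: eqP => [kl|_]; last first.
  by rewrite scale0r.
by rewrite kl wl in wk.
Qed.

Lemma br_wproj n x : br u (wproj n x) = wproj n (br u x).
Proof.
rewrite weight_wproj [in RHS](coord_basis e_basis (memvf x)) br_sumr.
rewrite [RHS]linear_sum [LHS]scaler_sumr big_mkcond; apply: eq_bigr => k _ /=.
rewrite -tnth_nth brZr e_weight !linearZ /= wproj_id.
by case: eqP => [->|_]; rewrite ?scaler0 // !scalerA mulrC.
Qed.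

(** [wproj n x] has both eigenvalues [n] and [l], so it is 0 for [n != l]; as [x] is the sum of its
    projections, only the one at [l] remains. *)
Lemma wproj_weight n l x : weight l x -> wproj n x = if n == l then x else 0.
Proof.
have ne i : i != l -> weight l x -> wproj i x = 0.
  move=> il wx; have := br_wproj i x; rewrite wx weight_wproj linearZ /=.
  move/eqP; rewrite -subr_eq0 -scalerBl scaler_eq0 subr_eq0 eqr_int (negPf il).
  by move/eqP.
move=> wx; case: eqP => [->|/eqP/ne]; last exact.
rewrite -[RHS]sum_wproj; case: (boolP (l \in weights)) => lw.
  by rewrite (bigD1_seq l) ?undup_uniq //= big1 ?addr0 // => i /ne ->.
(* Here [l] is not among the eigenvalues of the basis, and both sides are 0. *)
rewrite [wproj l x]big1 ?big_seq ?big1 // => [i iw|k /eqP wk].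
  by rewrite ne //; apply: contraNneq lw => <-.
by case/negP: lw; rewrite -wk mem_undup codom_f.
Qed.

Lemma br_even_anti x : br x u = - br u x.
Proof.
have [x0 [x1 [h0 h1 ->]]] := spart_split x.
rewrite brDl brDr (br_anti _ _ _ _ h0 u_even) (br_anti _ _ _ _ h1 u_even).
by rewrite !scale1r opprD.
Qed.

Lemma br_even_self : br u u = 0.
Proof.
have /eqP := br_even_anti u; rewrite -addr_eq0 -mulr2n -scaler_nat scaler_eq0.
by rewrite pnatr_eq0 => /eqP.
Qed.

Lemma weight_br n l x y : weight n x -> weight l y -> weight (n + l) (br x y).
Proof.
move=> wx wy; rewrite /weight br_even_leibniz // wx wy brZl brZr.
by rewrite -scalerDl -intrD.
Qed.

(** The parts of parity [~~ p] of the projections of [x] are weight vectors whose sum is 0, so each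
    of them is 0. *)
Lemma spart_wproj p n x : spart p x -> spart p (wproj n x).
Proof.
have /choice[z hz] k : exists z : L * L,
    [/\ spart p z.1, spart (~~ p) z.2 & wproj k x = z.1 + z.2].
  have [x0 [x1 [h0 h1 ex]]] := spart_split (wproj k x).
  case: p => /=; first by exists (x1, x0); rewrite addrC.
  by exists (x0, x1).
have cap (v : L) : spart p v -> spart (~~ p) v -> v = 0.
  by case: p {hz} => /= h1 h2; apply: spart_cap.
(* [br u - k] preserves parity and sends the two parts of [wproj k x] to opposite vectors of
   different parities, hence to 0. *)
have wz k : weight k (z k).2.
  have [h1 h2 ez] := hz k.
  have := weight_wproj k x; rewrite /weight ez brDr scalerDr => /eqP.
  rewrite -subr_eq0 opprD addrACA addr_eq0 => /eqP ew.
  apply/eqP; rewrite -subr_eq0 -oppr_eq0 -ew; apply/eqP/cap.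
    by apply: spartB; [exact: (br_spart _ _ _ _ u_even h1)|exact: spartZ].
  rewrite ew -scaleN1r; apply: spartZ.
  by apply: spartB; [exact: (br_spart _ _ _ _ u_even h2)|exact: spartZ].
move=> hx; have [h1 _ ez] := hz n.
have sum0 : \sum_(k <- weights) (z k).2 = 0.
  apply: cap; last by apply: spart_sum => k; have [] := hz k.
  rewrite -[X in spart p X](addKr (\sum_(k <- weights) (z k).1)) -big_split /=.
  under [X in - _ + X]eq_bigr => k _ do (have [_ _ <-] := hz k; over).
  rewrite sum_wproj addrC; apply: spartB => //.
  by apply: spart_sum => k; have [] := hz k.
suff z0 : (z n).2 = 0 by rewrite ez z0 addr0.
have := congr1 (wproj n) sum0; rewrite linear0 linear_sum /=.
under eq_bigr do rewrite (wproj_weight n (wz _)).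
case: (boolP (n \in weights)) => nw.
  rewrite (bigD1_seq n) ?undup_uniq //= eqxx big1 ?addr0 // => k.
  by rewrite eq_sym => /negPf ->.
(* Outside [weights] the projection is 0, so the two parts are opposite and [(z n).2] has both
   parities. *)
move=> _; have := ez; rewrite [wproj n x]big1; last first.
  by move=> k /eqP wk; case/negP: nw; rewrite -wk mem_undup codom_f.
have [_ h2 _] := hz n.
move/eqP; rewrite eq_sym addr_eq0 => /eqP e1; apply: cap => //.
rewrite -[(z n).2]opprK -e1 -scaleN1r; exact: spartZ.
Qed.

(** Moving [br u] across the invariant form gives [(n + l) * B x y = 0]. *)
Lemma bform_weight n l x y :
  weight n x -> weight l y -> n + l != 0 -> B x y = 0.
Proof.
move=> wx wy nl; have := bform_inv B x u y.
rewrite br_even_anti wx wy -scaleN1r !bformZl bformZr mulN1r => /eqP.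
rewrite eq_sym -subr_eq0 opprK -mulrDl -intrD mulf_eq0 intr_eq0 addrC.
by rewrite (negPf nl) => /eqP.
Qed.

Lemma bform_br_weight n x y : weight n x -> B u (br x y) = n%:~R * B x y.
Proof. by move=> wx; rewrite -bform_inv wx bformZl. Qed.

Lemma weightN0_notin n x : weight n x -> n \notin weights -> x = 0.
Proof.
move=> wx nw; rewrite -[x]sum_wproj big_seq big1 // => k kw.
by rewrite (wproj_weight _ wx); case: eqP => // kn; rewrite -kn kw in nw.
Qed.

(** Monomials in weight vectors span the loops, so additive identities need checking only there. *)
Lemma weight_loop_ind (P : loop L -> Prop) : P 0 ->
  (forall f g, P f -> P g -> P (f + g)) ->
  (forall i n x, weight n x -> P (mono i x)) -> forall f, P f.
Proof.
move=> P0 PD Pm; apply: loop_ind => // i x; rewrite -[x]sum_wproj.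
elim/big_ind: _ => [|y z hy hz|n _]; first by rewrite mono0.
  by rewrite monoD; apply: PD.
exact: Pm (weight_wproj n x).
Qed.

(** * Twisting loops by the weights *)

(** Degree [j] gathers the weight [n] parts of the coefficients [f i] with [2 * i + n = j]; finitely
    many [i] and [n] leave finitely many [j]. *)
Fact wtwist_subproof f :
  (fun j => \sum_(n <- weights)
     if (2 %| j - n)%Z then wproj n (f ((j - n) %/ 2)%Z) else 0)
  \in @loop_pred L.
Proof.
have [s us hs] := loop_seq f.
apply: (@loop_predI _ _ _ [seq 2 * i + n | i <- s, n <- weights]) => j.
apply: contra_neqT => hj; rewrite big_seq big1 // => n nw.
case: ifP => // jn; case: (eqVneq (f ((j - n) %/ 2)%Z) 0) => [->|/hs fs].
  by rewrite linear0.
case/allpairsP: hj; exists (((j - n) %/ 2)%Z, n); split=> //=.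
by rewrite mulrC divzK // subrK.
Qed.

(* x (x) t^i |-> x (x) t^(2 i + n) for x of weight n. *)
Definition wtwist f : loop L := Loop (wtwist_subproof f).

Lemma wtwist_lin a f g : wtwist (a *: f + g) = a *: wtwist f + wtwist g.
Proof.
apply: loopP => j; rewrite loopD loopZ /= scaler_sumr -big_split.
by apply: eq_bigr => n _ /=; case: ifP; rewrite ?linearP // scaler0 addr0.
Qed.

Lemma wtwistD f g : wtwist (f + g) = wtwist f + wtwist g.
Proof. by rewrite -{1}[f]scale1r wtwist_lin scale1r. Qed.

Lemma wtwist0 : wtwist 0 = 0.
Proof. by apply: (addrI (wtwist 0)); rewrite -wtwistD !addr0. Qed.

Lemma wtwistZ a f : wtwist (a *: f) = a *: wtwist f.
Proof. by rewrite -[a *: f]addr0 wtwist_lin wtwist0 addr0. Qed.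

Lemma wtwist_mono i n x : weight n x -> wtwist (mono i x) = mono (2 * i + n) x.
Proof.
(* The defining sum runs over [weights] only; for any other [n] the vector [x] is 0. *)
move=> wx; case: (boolP (n \in weights)) => nw; last first.
  by rewrite (weightN0_notin wx nw) !mono0 wtwist0.
apply: loopP => j; rewrite /= (bigD1_seq n) ?undup_uniq //= big1 ?addr0.
  rewrite -[j == _]subr_eq; case: ifP => [jn|/negP jn].
    rewrite -[in RHS](divzK jn) mulrC (inj_eq (mulfI _)) //.
    by case: eqP; rewrite ?linear0 // (wproj_weight _ wx) eqxx.
  case: eqP => // jn'; case: jn; rewrite jn'; exact: dvdz_mulr.
move=> l ln; case: ifP => // _; case: eqP => _; rewrite ?linear0 //.
by rewrite (wproj_weight _ wx) (negPf ln).
Qed.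

(** Distinct pairs (i, n) with equal [2 * i + n] differ in [n], so the weight separates what lands
    in one degree. *)
Lemma wproj_wtwist f i n : wproj n (wtwist f (2 * i + n)) = wproj n (f i).
Proof.
elim/weight_loop_ind: f => [|f g hf hg|k l x wx].
- by rewrite wtwist0 !linear0.
- by rewrite wtwistD !loopD !linearD /= hf hg.
rewrite (wtwist_mono _ wx) !monoE; case: (eqVneq n l) => [->|nl].
  by rewrite (inj_eq (addIr _)) (inj_eq (mulfI _)).
by case: ifP; case: ifP; rewrite ?linear0 // (wproj_weight _ wx) (negPf nl).
Qed.

(** Weights add under the bracket, hence so do the new degrees [2 * i + n]. *)
Lemma wtwist_lbr f g : wtwist (lbr f g) = lbr (wtwist f) (wtwist g).
Proof.
elim/weight_loop_ind: f => [|f f' hf hf'|i n x wx].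
- by rewrite !(lbr0l, wtwist0).
- by rewrite !(lbrDl, wtwistD) hf hf'.
elim/weight_loop_ind: g => [|f f' hf hf'|j l y wy].
- by rewrite !(lbr0r, wtwist0).
- by rewrite !(lbrDr, wtwistD) hf hf'.
rewrite lbr_mono (wtwist_mono _ wx) (wtwist_mono _ wy) lbr_mono.
by rewrite (wtwist_mono _ (weight_br wx wy)) mulrDr addrACA.
Qed.

(** The new degree is twice the old one plus the weight, which [mono 0 u] measures. *)
Lemma ldeg_wtwist f :
  ldeg (wtwist f) = 2 *: wtwist (ldeg f) + lbr (mono 0 u) (wtwist f).
Proof.
elim/weight_loop_ind: f => [|f f' hf hf'|i n x wx].
- by rewrite !(ldeg0, wtwist0, lbr0r, scaler0, addr0).
- by rewrite !(ldegD, wtwistD, lbrDr) hf hf' scalerDr addrACA.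
rewrite ldeg_mono wtwistZ (wtwist_mono _ wx) lbr_mono add0r wx monoZ.
by rewrite ldeg_mono scalerA -scalerDl intrD intrM.
Qed.

(** For monomials the left side is [(2 * i + n) * B x y] when both weights and old degrees cancel,
    and 0 otherwise; [2 * i] gives the old cocycle twice, and [n * B x y = B u (br x y)]. *)
Lemma lform_wtwist f g : lform B (ldeg (wtwist f)) (wtwist g)
  = 2 * lform B (ldeg f) g + B u (lbr f g 0).
Proof.
elim/weight_loop_ind: f => [|f f' hf hf'|i n x wx].
- by rewrite wtwist0 ldeg0 lbr0l !lform0l mulr0 bform0r addr0.
- rewrite wtwistD !(ldegD, lformDl, lbrDl, loopD, bformDr) hf hf' mulrDr.
  by rewrite addrACA.
elim/weight_loop_ind: g => [|f f' hf hf'|j l y wy].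
- by rewrite wtwist0 lbr0r !lform0r mulr0 bform0r addr0.
- by rewrite wtwistD !(lformDr, lbrDr, loopD, bformDr) hf hf' mulrDr addrACA.
rewrite lbr_mono (wtwist_mono _ wx) (wtwist_mono _ wy) !ldeg_mono !lformZl.
rewrite !lform_mono monoE [0 == _]eq_sym.
have -> : 2 * i + n + (2 * j + l) = 2 * (i + j) + (n + l).
  by rewrite mulrDr addrACA.
case: (eqVneq (n + l) 0) => [nl|/(bform_weight wx wy) Bxy].
  rewrite nl addr0 mulf_eq0 /=; case: eqP => _; last first.
    by rewrite !(mulr0, bform0r, addr0).
  by rewrite (bform_br_weight y wx) intrD intrM mulrDl mulrA.
case: (i + j == 0); rewrite ?(bform_br_weight y wx) Bxy;
  by rewrite !(if_same, mulr0, bform0r, addr0).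
Qed.

Lemma lspart_wtwist p f : lspart p f -> lspart p (wtwist f).
Proof.
move=> hf j; apply: spart_sum => n; case: ifP => _; last exact: spart0.
exact: spart_wproj.
Qed.

(** * Image of the twist and eigenspaces of [sigma] *)

Variable sigma : lsAut L.
Hypothesis sigma_weight : forall n x, weight n x -> sigma x = (-1) ^ n *: x.

Lemma sgeigen_wtwist f j : sgeigen sigma j (wtwist f j).
Proof.
elim/weight_loop_ind: f => [|f g hf hg|i n x wx].
- by rewrite wtwist0; apply: sgeigen0.
- by rewrite wtwistD loopD -[wtwist f j]scale1r; apply: sgeigen_lin.
rewrite (wtwist_mono _ wx) monoE; case: eqP => [->|_]; last exact: sgeigen0.
rewrite /sgeigen /= (sigma_weight wx) signz expfzDr ?oppr_eq0 ?oner_eq0 //.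
by rewrite -exprz_exp [(-1) ^ 2]sqrrN expr1n exp1rz mul1r.
Qed.

(** On the weight [n] part [sigma] acts both by (-1)^n and by (-1)^j, which are opposite for odd
    [j - n]. *)
Lemma wproj_sgeigen j n x :
  sgeigen sigma j x -> ~~ (2 %| j - n)%Z -> wproj n x = 0.
Proof.
move=> sx jn; have : wproj n (sigma x) = (-1) ^ n *: wproj n x.
  rewrite -{1}[x]sum_wproj linear_sum /= linear_sum /=.
  rewrite -[in RHS](sum_wproj x) [X in _ *: X]linear_sum scaler_sumr.
  apply: eq_bigr => k _ /=.
  have wk := weight_wproj k x; rewrite (sigma_weight wk) linearZ /=.
  by rewrite (wproj_weight _ wk); case: eqP => [->|_]; rewrite ?scaler0.
rewrite sx signz linearZ /= -{1}[j](subrK n).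
rewrite expfzDr ?oppr_eq0 ?oner_eq0 //.
rewrite -(signz F (j - n)) -signr_odd.
have -> : odd `|j - n|%N by move: jn; rewrite dvdzE dvdn2 negbK.
rewrite expr1 mulN1r scaleNr => /eqP; rewrite eq_sym -addr_eq0.
rewrite -scalerDl scaler_eq0 -mulr2n mulrn_eq0 expfz_eq0 oppr_eq0 oner_eq0.
by rewrite andbF => /eqP.
Qed.

(** Only weights [n] with [j - n] even occur in degree [j], and these come from degree (j - n) /
    2. *)
Lemma wtwist_surj f : (forall j, sgeigen sigma j (f j)) ->
  exists g, wtwist g = f.
Proof.
move=> hf; have [s ->] := loop_sum f.
elim/big_ind: _ => [|_ _ [g <-] [g' <-]|j _].
- by exists 0; rewrite wtwist0.
- by exists (g + g'); rewrite wtwistD.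
rewrite -[f j]sum_wproj.
elim/big_ind: _ => [|y z [g hg] [g' hg']|n _].
- by exists 0; rewrite mono0 wtwist0.
- by exists (g + g'); rewrite monoD -hg -hg' wtwistD.
case: (boolP (2 %| j - n)%Z) => jn; last first.
  by exists 0; rewrite (wproj_sgeigen (hf j) jn) mono0 wtwist0.
exists (mono ((j - n) %/ 2)%Z (wproj n (f j))).
by rewrite (wtwist_mono _ (weight_wproj n _)) mulrC divzK // subrK.
Qed.

Lemma wtwist_inj : injective wtwist.
Proof.
move=> f g fg; apply: loopP => i; rewrite -[f i]sum_wproj -[g i]sum_wproj.
by apply: eq_bigr => n _; rewrite -(wproj_wtwist f) -(wproj_wtwist g) fg.
Qed.

(** * The spectral flow is an isomorphism *)

Lemma weight_self : weight 0 u.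
Proof. by rewrite /weight br_even_self scale0r. Qed.

(* d - u acts on x (x) t^(2 i + n), x of weight n, as 2 i; the term
   B u (aloop X 0) absorbs the change of the cocycle under wtwist. *)
Definition flow (X : affine B) : affine B :=
  (wtwist (aloop X) - (acd X / 2) *: mono 0 u,
   2 * acK X + B u (aloop X 0), acd X / 2).

Lemma aloop_flow X : aloop (flow X) =
  wtwist (aloop X) - (acd X / 2) *: mono 0 u.
Proof. by []. Qed.

Lemma acK_flow X : acK (flow X) = 2 * acK X + B u (aloop X 0).
Proof. by []. Qed.

Lemma acd_flow X : acd (flow X) = acd X / 2.
Proof. by []. Qed.

Fact flow_twisted X : flow X \in twisted_pred B sigma.
Proof.
apply/twP => j; rewrite aloop_flow addrC -scaleNr.
rewrite loopD loopZ; apply: sgeigen_lin; last exact: sgeigen_wtwist.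
rewrite monoE; case: eqP => [->|_]; last exact: sgeigen0.
by rewrite /sgeigen /= (sigma_weight weight_self).
Qed.

Definition twflow X : twisted B sigma := Twisted (flow_twisted X).

Fact twflow_lin a X Y : twflow (a *: X + Y) = a *: twflow X + twflow Y.
Proof.
have twD (U V : twisted B sigma) : twval (a *: U + V) = a *: twval U + twval V.
  by [].
apply: val_inj; rewrite [LHS]/= [RHS]twD /=; apply: affineP.
- rewrite aloop_lin !aloop_flow aloop_lin acd_lin wtwist_lin mulrDl scalerDl.
  by rewrite opprD scalerBr addrACA scalerA mulrA.
- rewrite acK_lin !acK_flow acK_lin aloop_lin loopD loopZ bform_linr.
  by rewrite !mulrDr addrACA mulrCA.
- by rewrite acd_lin !acd_flow acd_lin mulrDl mulrA.
Qed.

HB.instance Definition _ := GRing.isLinear.Build F (affine B) (twisted B sigma)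
  *:%R twflow twflow_lin.

(** The flow is triangular: the coefficient of d is recovered first, then the loop, then the
    coefficient of K. *)
Lemma twflow_bij : bijective twflow.
Proof.
have two_neq0 : (2 : F) != 0 by rewrite pnatr_eq0.
have inj : injective twflow.
  move=> X Y /(congr1 (@twval _ _ _ _)) /= XY.
  have ed : acd X = acd Y.
    move/(congr1 (@acd _ _ _)): XY; rewrite !acd_flow.
    by apply: mulIf; rewrite invr_eq0.
  have el : aloop X = aloop Y.
    move/(congr1 (@aloop _ _ _)): XY; rewrite !aloop_flow ed.
    by move/addIr/wtwist_inj.
  apply: affineP => //; apply: (mulfI two_neq0).
  apply: (addIr (B u (aloop X 0))).
  by move/(congr1 (@acK _ _ _)): XY; rewrite !acK_flow -el.
have /choice[inv invK] Y : exists X, twflow X = Y.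
  (* [acd (twval Y)] is already the halved coefficient, so this multiple of [u] restores what the
     flow subtracts. *)
  have hY : forall j,
      sgeigen sigma j ((aloop (twval Y) + acd (twval Y) *: mono 0 u) j).
    have /twP hY := valP Y; move=> j; rewrite addrC loopD loopZ.
    apply: sgeigen_lin; last exact: hY.
    rewrite monoE; case: eqP => [->|_]; last exact: sgeigen0.
    by rewrite /sgeigen /= (sigma_weight weight_self).
  have [f hf] := wtwist_surj hY.
  exists (f, (acK (twval Y) - B u (f 0)) / 2, acd (twval Y) * 2).
  apply/val_inj/affineP; rewrite [twval _]/=.
  - by rewrite aloop_flow hf mulfK // addrK.
  - by rewrite acK_flow mulrC divfK // subrK.
  - by rewrite acd_flow mulfK.
by exists inv => // X; apply: inj; rewrite invK.
Qed.

(** For odd [X] the coefficient of d is 0, which removes the even term in [u], and [B u] vanishes on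
    odd vectors. *)
Lemma twflow_spart p X : spart p X -> spart p (twflow X).
Proof.
move=> [hX hp]; split=> [j|/[dup] hp1 /hp [eK ed]].
  rewrite aloop_flow addrC -scaleNr loopD loopZ.
  apply: spartD; last exact: lspart_wtwist.
  case: p hp hX => [/(_ isT)[_ ->] _|_ _].
    by rewrite mul0r oppr0 scale0r; apply: spart0.
  by apply: spartZ; rewrite monoE; case: eqP => // _; apply: spart0.
rewrite acK_flow acd_flow eK ed mulr0 add0r mul0r; split=> //.
by apply: bform_even => //; move: (hX 0); rewrite hp1.
Qed.

Lemma lbr_mono_weight0 f : lbr f (mono 0 u) = - lbr (mono 0 u) f.
Proof.
elim/loop_ind: f => [|f g hf hg|i x]; first by rewrite lbr0l lbr0r oppr0.
  by rewrite lbrDl lbrDr hf hg opprD.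
by rewrite !lbr_mono br_even_anti monoN addrC.
Qed.

(** In the loop part the brackets with [u] cancel the weight terms of [ldeg_wtwist]; in the K part
    [lform_wtwist] yields exactly the correction [B u]. *)
Lemma twflow_br X Y : twflow (br X Y) = br (twflow X) (twflow Y).
Proof.
have two_neq0 : (2 : F) != 0 by rewrite pnatr_eq0.
have ldegu c : ldeg (c *: mono 0 u) = 0.
  by rewrite ldegZ ldeg_mono mulr0z scale0r scaler0.
apply: val_inj; rewrite [LHS]/= -[RHS]/(abr (flow X) (flow Y)).
rewrite -[br X Y]/(abr X Y); apply: affineP.
- rewrite aloop_flow !aloop_br !aloop_flow acd_br !acd_flow mul0r scale0r subr0.
  move: (aloop X) (aloop Y) => f g.
  (* [b] and [d] stand for the halved coefficients, so that no division remains. *)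
  rewrite -[in LHS](divfK two_neq0 (acd X)) -[in LHS](divfK two_neq0 (acd Y)).
  move: (acd X / 2) (acd Y / 2) => b d; rewrite -!scaleNr.
  rewrite !(wtwistD, wtwistZ, ldegD, ldegu) !addr0 wtwist_lbr !ldeg_wtwist.
  rewrite !(lbrDl, lbrDr, lbrZl, lbrZr) lbr_mono_weight0 lbr_mono br_even_self.
  rewrite mono0 !scaler0 addr0.
  rewrite !(@scalerDr _ (loop L), scalerN, scaleNr, scalerA) opprK.
  by rewrite !opprD !addrA [RHS](ACl (1*4*6*(2*7)*(3*5))) /= subrr addNr !addr0.
(* A derivative has no constant term, so it pairs to 0 with [mono 0 u]. *)
- have lformu f : lform B (ldeg f) (mono 0 u) = 0.
    by rewrite lform_ldeg ldeg_mono mulr0z scale0r lform0r oppr0.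
  rewrite acK_flow !acK_br aloop_br !aloop_flow.
  rewrite -!scaleNr !(ldegD, ldegu) addr0 lformDr lformZr lformu mulr0 addr0.
  rewrite lform_wtwist !loopD !loopZ !ldegE !mulr0z !scale0r !scaler0.
  by rewrite !addr0.
- by rewrite acd_flow !acd_br mul0r.
Qed.

Lemma affine_iso_twisted : lsiso (affine B) (twisted B sigma).
Proof.
exists twflow; split; [exact: twflow_bij|exact: twflow_spart|exact: twflow_br].
Qed.

End WeightDecomposition.

(** * Eigenvalues of Cartan elements *)

Section RootWeights.
Variables (F : numFieldType) (L : finLieSuperType F).

(** The product of the operators [ad t - c]; the head acts first, so the partial products form a
    chain of vectors. *)
Definition adprod (t : L) (cs : seq F) (x : L) : L :=
  foldl (fun y c => br t y - c *: y) x cs.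

Lemma adprod_lin t cs a x y :
  adprod t cs (a *: x + y) = a *: adprod t cs x + adprod t cs y.
Proof.
rewrite /adprod; elim: cs x y => //= c cs IH x y; rewrite -IH; congr foldl.
by rewrite br_linr scalerDr opprD addrACA scalerBr !scalerA mulrC.
Qed.

Lemma adprod0 t cs : adprod t cs 0 = 0.
Proof.
have := adprod_lin t cs (-1) 0 0.
by rewrite !scaler0 addr0 scaleN1r addNr.
Qed.

Lemma adprodZ t cs a x : adprod t cs (a *: x) = a *: adprod t cs x.
Proof. by have := adprod_lin t cs a x 0; rewrite adprod0 !addr0. Qed.

Lemma adprod_eigen t cs c x : br t x = c *: x ->
  adprod t cs x = (\prod_(d <- cs) (c - d)) *: x.
Proof.
move=> tx; elim: cs => [|d cs IH]; first by rewrite big_nil scale1r.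
rewrite -[LHS]/(adprod t cs (br t x - d *: x)).
by rewrite tx -scalerBl adprodZ IH scalerA big_cons.
Qed.

(** With [cs] the eigenvalues along an eigenbasis, each basis vector is killed by its own factor. *)
Lemma ad_diagonalizable_prod t : ad_diagonalizable t ->
  exists cs, forall x, adprod t cs x = 0.
Proof.
move=> [e e_basis he].
have /choice[c hc] x : exists c : F, x \in e -> br t x = c *: x.
  by case: (boolP (x \in e)) => [/he[c hc]|_]; [exists c|exists 0].
exists [seq c x | x <- e] => x.
rewrite (@coord_basis _ _ _ _ (in_tuple e) x e_basis (memvf x)).
elim/big_ind: _ => [|y z hy hz|i _]; first exact: adprod0.
  by rewrite -[y]scale1r adprod_lin hy hz scaler0 addr0.
rewrite adprodZ.
have ei : e`_i \in e by rewrite mem_nth.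
rewrite (adprod_eigen _ (hc _ ei)) big_map (big_rem _ ei) /= subrr mul0r.
by rewrite scale0r scaler0.
Qed.

Variable H : {vspace L}.
Hypothesis Hcartan : cartan_subalg H.
Implicit Types (t z x y : L).

Lemma cartan_even t : t \in H -> spart false t.
Proof. by case: Hcartan => h1 _ _ _ /h1. Qed.

Lemma cartan_ad_comm t z x : t \in H -> z \in H ->
  br z (br t x) = br t (br z x).
Proof.
case: Hcartan => _ hab _ _ tH zH.
by rewrite (br_even_leibniz _ _ (cartan_even zH)) (hab z t) // br0l add0r.
Qed.

(* The last nonzero vector in the chain of the partial products of
   prod_c (ad t - c) applied to x is an eigenvector of ad t. *)
Lemma cartan_eigen_refine t x : t \in H -> x != 0 ->
  exists y, [/\ y != 0, exists c, br t y = c *: y &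
    forall z c, z \in H -> br z x = c *: x -> br z y = c *: y].
Proof.
move=> tH; have [_ _ _ /(_ t tH)/ad_diagonalizable_prod[cs /(_ x)]] := Hcartan.
elim: cs x => [|c cs IH] x /=; first by rewrite /adprod /= => -> /eqP.
case: (eqVneq (br t x - c *: x) 0) => [/eqP tx _ x0|x1 ap _].
  by exists x; split=> //; exists c; apply/eqP; rewrite -subr_eq0.
have [y [y0 ty yz]] := IH _ ap x1; exists y; split=> // z d zH zx.
(* [br z] commutes with [br t], so [br t x - c *: x] keeps the eigenvalue [d] of [x]. *)
apply: yz => //; rewrite brDr -scaleNr brZr (cartan_ad_comm _ tH zH) zx brZr.
by rewrite scalerDr !scalerA [d * _]mulrC.
Qed.

(** Elements of [ts] are treated one by one; the last clause preserves the eigenvalues already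
    obtained. *)
Lemma cartan_common_eigen (ts : seq L) x : {subset ts <= H} -> x != 0 ->
  exists y, [/\ y != 0, forall t, t \in ts -> exists c, br t y = c *: y &
    forall z c, z \in H -> br z x = c *: x -> br z y = c *: y].
Proof.
elim: ts => [|t ts IH] tsH x0; first by exists x.
have [z zts|y [y0 yts yz]] := IH _ x0.
  by apply: tsH; rewrite inE zts orbT.
have tH : t \in H by apply: tsH; rewrite mem_head.
have [v [v0 vt vz]] := cartan_eigen_refine tH y0.
exists v; split=> // [s|z c zH zx]; last by apply: vz => //; apply: yz.
rewrite inE => /predU1P[->//|sts]; have [c sy] := yts s sts.
by exists c; apply: vz => //; apply: tsH; rewrite inE sts orbT.
Qed.

(** A joint eigenvector for a basis of [H] is one for all of [H]; its eigenvalue is linear since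
    [y != 0] makes it unique. *)
Lemma cartan_weight_vector t c x : t \in H -> x != 0 -> br t x = c *: x ->
  exists y (a : 'Hom(subvs_of H, F^o)), [/\ y != 0, br t y = c *: y &
    forall s, br (vsval s) y = a s *: y].
Proof.
move=> tH x0 tx.
have vH : {subset vbasis H <= H} by move=> v /vbasis_mem.
have [y [y0 yH yz]] := cartan_common_eigen vH x0.
exists y.
have /choice[a ha] (s : subvs_of H) : exists d : F, br (vsval s) y = d *: y.
  rewrite (coord_vbasis (subvsP s)).
  elim/big_ind: _ => [|v w [dv ev] [dw ew]|i _].
  - by exists 0; rewrite br0l scale0r.
  - by exists (dv + dw); rewrite brDl ev ew scalerDl.
  have [|d ed] := yH (vbasis H)`_i; first by rewrite mem_nth ?size_tuple.
  by exists (coord (vbasis H) i (vsval s) * d); rewrite brZl ed scalerA.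
have a_lin : linear (a : subvs_of H -> F^o).
  move=> k s s'; apply/eqP; rewrite -subr_eq0.
  have /eqP := ha (k *: s + s'); rewrite linearP br_linl !ha scalerA -scalerDl.
  by rewrite -subr_eq0 -scalerBl scaler_eq0 (negPf y0) orbF -oppr_eq0 opprB.
pose aL := GRing.isLinear.Build _ _ _ _ a a_lin.
pose ah : {linear subvs_of H -> F^o} := HB.pack a aL.
exists (linfun ah); split=> //; first exact: yz.
by move=> s; rewrite lfunE ha.
Qed.

(** [c] is the value at [t] of a weight; a nonzero weight is a root, an integral combination of
    simple roots, of which only the first contributes at [t]. *)
Lemma simple_roots_integral (alpha : 3.-tuple 'Hom(subvs_of H, F^o))
    (t : subvs_of H) p c x :
  simple_roots alpha -> tnth alpha 0 t = p -> tnth alpha 1 t = 0 ->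
  tnth alpha 2%:R t = 0 -> x != 0 -> br (vsval t) x = c *: x ->
  exists n : int, c = n%:~R * p.
Proof.
move=> [_ _ hroot] t0 t1 t2 x0 tx.
have [y [a [y0 ty ya]]] := cartan_weight_vector (subvsP t) x0 tx.
have ca : a t = c.
  apply/eqP; rewrite -subr_eq0; move/eqP: (ya t).
  by rewrite ty -subr_eq0 -scalerBl scaler_eq0 (negPf y0) orbF -oppr_eq0 opprB.
(* The zero weight is not a root; it falls under [c = 0]. *)
case: (eqVneq c 0) => [->|c0]; first by exists 0; rewrite mul0r.
have a_root : is_root a.
  split; last by exists y.
  by apply: contraNneq c0 => a0; rewrite -ca a0 zero_lfunE.
have eval (n : 'I_3 -> nat) : (\sum_i tnth alpha i *+ n i) t = (n 0)%:R * p.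
  have evalMn k (f : 'Hom(subvs_of H, F^o)) : (f *+ k) t = f t *+ k.
    by elim: k => [|k IH]; rewrite ?zero_lfunE // !mulrS add_lfunE IH.
  rewrite sum_lfunE !big_ord_recl big_ord0.
  have -> : lift ord0 ord0 = 1 :> 'I_3 by apply: val_inj.
  have -> : lift ord0 (lift ord0 ord0) = 2%:R :> 'I_3 by apply: val_inj.
  by rewrite !evalMn t0 t1 t2 !mul0rn !addr0 mulr_natl.
have [n [an|an]] := hroot a a_root; rewrite -ca an.
  by exists (n 0); rewrite eval.
by exists (- (n 0)%:Z); rewrite opp_lfunE eval mulrNz mulNr.
Qed.

End RootWeights.

(** * The complex exponential at integer multiples of pi i *)

Section ComplexExponential.
Variable R : realType.

Lemma cvg_complex (f g : nat -> R) (a b : R) :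
  f @ \oo --> a -> g @ \oo --> b ->
  (fun n => (f n +i* g n)%C : R[i]^o) @ \oo --> ((a +i* b)%C : R[i]^o).
Proof.
move=> /cvgrPdist_lt fa /cvgrPdist_lt gb; apply/cvgrPdist_lt => e.
rewrite ltcE /= => /andP[/eqP Ime e0].
(* A positive element of [R[i]] is real, so [e] splits into two real halves. *)
have [r r0 ->] : exists2 r, 0 < r & e = r%:C%C + r%:C%C.
  exists (complex.Re e / 2); first by rewrite divr_gt0.
  by rewrite -rmorphD -splitr; case: e Ime {e0} => x y /= ->.
have normC (x : R) : `|x%:C%C| = `|x|%:C%C.
  by rewrite normc_def /= expr0n addr0 sqrtr_sqr.
apply: filterS2 (fa _ r0) (gb _ r0) => n fan gbn.
have -> : (a +i* b)%C - (f n +i* g n)%C =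
    (a - f n)%:C%C + 'i%C * (b - g n)%:C%C :> R[i].
  by simpc.
apply: le_lt_trans (ler_normD _ _) _.
have -> : `|'i%C * (b - g n)%:C%C| = `|b - g n|%:C%C.
  by rewrite normrM normc_def /= expr0n add0r expr1n sqrtr1 mul1r normC.
by rewrite normC; apply: ltrD; rewrite ltcR.
Qed.

(** Euler's formula: even powers of i give the cosine series, odd powers the sine series. *)
Lemma cvg_series_expi (y : R) :
  (fun m => \sum_(k < m) (k`!%:R)^-1 * (y%:C%C * 'i%C) ^+ k : R[i]^o) @ \oo
    --> ((cos y +i* sin y)%C : R[i]^o).
Proof.
rewrite (_ : (fun _ => _) = fun m =>
    (series (cos_coeff y) m +i* series (sin_coeff y) m)%C : R[i]^o).
  by apply: cvg_complex; rewrite unlock;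
    [exact: is_cvg_series_cos_coeff|exact: is_cvg_series_sin_coeff].
apply/funext => m; rewrite /series /= !big_mkord.
have -> (f g : nat -> R) : ((\sum_(k < m) f k) +i* (\sum_(k < m) g k))%C =
    \sum_(k < m) (f k +i* g k)%C.
  by elim: m => [|m IH]; rewrite ?big_ord0 // !big_ord_recr /= -IH; simpc.
apply: eq_bigr => k _.
rewrite exprMn -rmorphXn -[k`!%:R](rmorph_nat (real_complex R)).
have -> : 'i%C ^+ k = (if odd k then 'i%C else 1) * ((-1) ^+ k./2)%:C%C :> R[i].
  rewrite -{1}(odd_double_half k) exprD -mul2n exprM sqr_i rmorph_sign.
  by case: odd.
rewrite -fmorphV /sin_coeff /cos_coeff /=.
case: (boolP (odd k)) => k_odd /=.
  (* The sine coefficient carries the exponent [k.-1./2], equal to [k./2] for odd [k]. *)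
  have -> : k.-1./2 = k./2 by rewrite -{1}(odd_double_half k) k_odd /= doubleK.
  by simpc; congr (_ +i* _)%C; rewrite mulrC [y ^+ k * _]mulrC.
by simpc; congr (_ +i* _)%C; rewrite mulrC [y ^+ k * _]mulrC.
Qed.

Lemma cos_natpi (n : nat) : cos (n%:R * pi) = (-1) ^+ n :> R.
Proof.
by rewrite mulr_natl -[_ *+ _]add0r (alternatingn (@cosDpi R)) cos0 mulr1.
Qed.

Lemma sin_natpi (n : nat) : sin (n%:R * pi) = 0 :> R.
Proof.
by rewrite mulr_natl -[_ *+ _]add0r (alternatingn (@sinDpi R)) sin0 mulr0.
Qed.

Lemma expi_intpi (n : int) :
  (cos (n%:~R * pi) +i* sin (n%:~R * pi))%C = (-1) ^ n :> R[i].
Proof.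
rewrite -signz; case: n => n.
  by rewrite -pmulrn cos_natpi sin_natpi -[RHS](rmorph_sign (real_complex R) _).
rewrite NegzE mulrNz mulNr cosN sinN -pmulrn cos_natpi sin_natpi oppr0.
by rewrite abszN -[RHS](rmorph_sign (real_complex R) _).
Qed.

(** On an eigenvector each coordinate of the series is the scalar exponential series times that
    coordinate of [x]; limits are unique. *)
Lemma exp_ad_eigen (L : finLieSuperType R[i]) (t : L) (sigma : L -> L) x
    (n : int) : is_exp_ad t sigma ->
  br t x = (n%:~R * (pi%:C%C * 'i%C)) *: x -> sigma x = (-1) ^ n *: x.
Proof.
move=> hsigma tx.
rewrite (coord_vbasis (memvf (sigma x))) [in RHS](coord_vbasis (memvf x)).
rewrite scaler_sumr; apply: eq_bigr => i _; rewrite scalerA; congr (_ *: _).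
have {}tx : br t x = ((n%:~R * pi)%:C%C * 'i%C) *: x.
  by rewrite tx rmorphM rmorph_int mulrA.
have iterE k : iter k (br t) x = ((n%:~R * pi)%:C%C * 'i%C) ^+ k *: x.
  elim: k => [|k IH]; first by rewrite scale1r.
  by rewrite iterS IH brZr tx scalerA exprSr.
move: (hsigma x i).
rewrite (_ : (fun _ => _) = fun m => (\sum_(k < m) (k`!%:R)^-1 *
    ((n%:~R * pi)%:C%C * 'i%C) ^+ k : R[i]^o) * coord (vbasis {: L}) i x).
  have := @cvg_series_expi (n%:~R * pi); rewrite expi_intpi => cE cS.
  apply: (cvg_unique _ cS); first exact: norm_hausdorff.
  exact: cvgMl cE.
apply/funext => m; rewrite linear_sum mulr_suml; apply: eq_bigr => k _ /=.
by rewrite linearZ iterE linearZ /=; exact: mulrA.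
Qed.

End ComplexExponential.

(** * The isomorphism for G(3) *)

Theorem mainTheorem9 (R : realType) (g : finLieSuperType R[i])
    (Hg : is_G3 g) (B : invForm g)
    (h : {vspace g}) (Hh : cartan_subalg h)
    (alpha : 3.-tuple 'Hom(subvs_of h, R[i]^o)) (Halpha : simple_roots alpha)
    (h0 : subvs_of h)
    (Hh1 : tnth alpha 0 h0 = pi%:C%C * 'i%C)
    (Hh2 : tnth alpha 1 h0 = 0)
    (Hh3 : tnth alpha 2%:R h0 = 0)
    (sigma : lsAut g) (Hsigma : is_exp_ad (vsval h0) sigma) :
  lsiso (affine B) (twisted B sigma).
Proof.
set p := pi%:C%C * 'i%C in Hh1.
have p0 : p != 0.
  rewrite mulf_neq0 ?neq0Ci // -(rmorph0 (real_complex R)).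
  rewrite (inj_eq (@complexI R)).
  exact: lt0r_neq0 (pi_gt0 R).
(* Dividing by [p], which is pi i, makes the eigenvalues integers. *)
pose u := p^-1 *: vsval h0.
have eigen c x : br u x = c *: x <-> br (vsval h0) x = (c * p) *: x.
  rewrite /u brZl; split=> [e|->]; last by rewrite scalerA mulrC mulfK.
  by rewrite mulrC -scalerA -e scalerA mulfV // scale1r.
have [hev _ _ hdiag] := Hh.
have u_even : spart false u by apply/spartZ/hev/subvsP.
have [e e_basis he] := hdiag _ (subvsP h0).
(* An eigenbasis for [h0] serves as the weight basis; integrality of the roots supplies the
   weights. *)
have /choice[w hw] (k : 'I_(size e)) : exists n : int,
    br u (tnth (in_tuple e) k) = n%:~R *: tnth (in_tuple e) k.
  have ek : tnth (in_tuple e) k \in e by apply: mem_tnth.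
  have e0 : tnth (in_tuple e) k != 0.
    apply: contraTneq (basis_free e_basis) => e0; apply/negP.
    by move/free_not0 => /(_ _ ek); rewrite e0 eqxx.
  have [c hc] := he _ ek.
  have [n cn] := simple_roots_integral Hh Halpha Hh1 Hh2 Hh3 e0 hc.
  by exists n; apply/eigen; rewrite -cn.
apply: (@affine_iso_twisted _ _ _ u _ (in_tuple e) w e_basis u_even hw) => n x.
by move/eigen/(exp_ad_eigen Hsigma).
Qed.
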